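(* Let $F$ be an algebraically closed field and let $A$ be a prolongable monomial $F$-algebra. If $\mathcal P(A)$ is irreducible, then there exists a nilpotent ideal $N\triangleleft A$, generated by a (possibly empty) subset of the set of monomial generators of $A$, such that $A/N\cong F\langle x_1,\dots,x_k\rangle$ for some $k$.
   Context: A monomial algebra is a quotient $A=F\langle x_1,\dots,x_m\rangle/I$ of a free associative algebra by a proper ideal generated by monomials, graded by $\deg x_i=1$; its monomial generators are (the images of) $x_1,\dots,x_m$. It is (right) prolongable if for every non-zero monomial $u\in A$ there is a non-empty monomial $v$ with $uv\ne0$. A point module is a graded cyclic right $A$-module $P=\bigoplus_{n\ge0}P_n$ generated in degree $0$ with all $\dim_F P_n=1$. Writing $P_i=Fe_i$, $e_i\cdot x_j=\lambda_{i,j}e_{i+1}$, its isomorphism class is recorded by $(\underline\lambda_0,\underline\lambda_1,\dots)\in\mathbb P^{m-1}\times\mathbb P^{m-1}\times\cdots$, $\underline\lambda_i=[\lambda_{i,1}:\cdots:\lambda_{i,m}]$. $\mathcal P_n(A)\subseteq(\mathbb P^{m-1})^{\times(n+1)}$ is the projection of the set of all such sequences to the first $n+1$ factors (a projective variety), and $\mathcal P(A)=\{(\mathcal P_n(A),\pi_n)\}_{n\ge0}$ with $\pi_n\colon\mathcal P_{n+1}(A)\to\mathcal P_n(A)$ the natural projections. $\mathcal P(A)$ is irreducible if every $\mathcal P_n(A)$ is an irreducible variety. *)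

(* Defs.v *)
From HB Require Import structures.
From mathcomp Require Import all_boot all_order all_algebra.
From mathcomp Require Import monalg.
From mathcomp Require Import mpoly.

Set Implicit Arguments.
Unset Strict Implicit.
Unset Printing Implicit Defensive.

Import GRing.Theory.
Local Open Scope ring_scope.

(* monalg equips {malg F[K]} with an algType structure only for commutative K;
   the alias freealg carries it for the free monoid on m letters. *)
Definition freealg (F : fieldType) (m : nat) : predArgType :=
  {malg F[{fmonom 'I_m}]}.

HB.instance Definition _ (F : fieldType) (m : nat) := GRing.Lalgebra.on (freealg F m).

Fact freealg_scalerAr (F : fieldType) m (c : F) (p q : freealg F m) :
  c *: (p * q) = p * (c *: q).
Proof.
have mulC (g : {malg F[{fmonom 'I_m}]}) : g * monalg.mkmalgU mone c = c *: g.
  rewrite malgM_def fgmulgU -mul_malgC malgM_def fgmulUg.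
  by apply: eq_bigr => k _; rewrite mul1m mulm1 mulrC.
exact: etrans (esym (mulC (p * q)))
  (etrans (esym (mulrA p q _)) (congr1 ( *%R p) (mulC q))).
Qed.

HB.instance Definition _ (F : fieldType) (m : nat) :=
  GRing.Lalgebra_isAlgebra.Build F (freealg F m) (@freealg_scalerAr F m).

Section Ideals.
Variable R : nzRingType.

Definition two_sided_ideal (J : R -> Prop) : Prop :=
  [/\ J 0, (forall x y, J x -> J y -> J (x + y))
    & (forall a x, J x -> J (a * x) /\ J (x * a))].

Definition ideal_gen (S : R -> Prop) : R -> Prop := fun x =>
  forall J, two_sided_ideal J -> (forall s, S s -> J s) -> J x.

(* J ^ n = 0, where J ^ n is additively spanned by the n-fold products *)
Definition nilpotent_ideal (J : R -> Prop) : Prop :=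
  exists n, forall a : 'I_n -> R, (forall i, J (a i)) -> \prod_(i < n) a i = 0.

End Ideals.

(* pi exhibits B as the quotient algebra A / J. As B is a non-trivial ring,
   J is then a proper ideal. *)
Definition quotient_map (F : fieldType) (A B : algType F)
    (J : A -> Prop) (pi : {lrmorphism A -> B}) : Prop :=
  [/\ two_sided_ideal J, (forall b, exists a, pi a = b)
    & (forall a, pi a = 0 <-> J a)].

Definition alg_isomorphic (F : fieldType) (A B : algType F) : Prop :=
  exists f : {lrmorphism A -> B}, bijective f.

Section MonomialAlgebra.
Variables (F : fieldType) (m : nat) (A : algType F).
Variable phi : {lrmorphism freealg F m -> A}.

Definition word_elt (w : {fmonom 'I_m}) : freealg F m := monalg.mkmalgU w 1.

(* phi presents A as the quotient of the free algebra on x_1, ..., x_m by an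
   ideal generated by a set W of monomials. *)
Definition monomial_algebra : Prop :=
  exists W : {fmonom 'I_m} -> Prop,
    quotient_map (ideal_gen (fun p => exists2 w, W w & p = word_elt w)) phi.

Definition monomial (w : {fmonom 'I_m}) : A := phi (word_elt w).

Definition generator (i : 'I_m) : A := monomial (fmu i).

Definition prolongable : Prop :=
  forall u, monomial u <> 0 ->
  exists2 v, (0 < fdeg v)%N & monomial u * monomial v <> 0.

Definition homog_part (n : nat) (a : A) : Prop :=
  exists2 p : freealg F m,
    (forall w, monalg.mcoeff w p != 0 -> fdeg w = n) & phi p = a.

(* A right A-module is a left module over the converse ring A^c; c in F acts
   on it as c%:A. *)
Definition ract (P : lmodType A^c) (x : P) (a : A) : P := (a : A^c) *: x.

Record point_module (P : lmodType A^c) (G : nat -> P -> Prop) : Prop :=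
  PointModule {
    point_dim1 : forall n, exists2 e, e <> 0 &
      forall x, G n x <-> exists c : F, x = ract e c%:A;
    point_sum : forall x, exists N (y : nat -> P),
      (forall n, G n (y n)) /\ x = \sum_(n < N) y n;
    point_direct : forall N (y : nat -> P),
      (forall n, G n (y n)) -> \sum_(n < N) y n = 0 ->
      forall n, (n < N)%N -> y n = 0;
    point_graded : forall i j x a,
      G i x -> homog_part j a -> G (i + j)%N (ract x a);
    point_cyclic : exists2 x0, G 0%N x0 & forall x, exists a, x = ract x0 a
  }.

End MonomialAlgebra.

Section ProjectiveSpace.
Variables (F : fieldType) (m : nat).

(* P^(m-1) is the set of lines through the origin of F^m; the point
   [l_1 : ... : l_m] is the line <[l]>. *)
Definition proj_space := {L : {vspace 'rV[F]_m} | \dim L == 1%N}.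

Variable n : nat.

(* The coordinate ring of (P^(m-1))^n has n * m variables; the j-th homogeneous
   coordinate on the i-th factor has index mxvec_index i j. *)
Definition multihomogeneous (p : mpoly (n * m) F) : Prop :=
  exists d : 'I_n -> nat, forall mu, mu \in mpoly.msupp p ->
    forall i, (\sum_(j < m) mu (mxvec_index i j))%N = d i.

Definition vanishes_at (p : mpoly (n * m) F) (x : {ffun 'I_n -> proj_space}) :
    Prop :=
  forall v : 'M[F]_(n, m), (forall i, val (x i) = <[row i v]>%VS) ->
    p.@[fun k => mxvec v 0 k] = 0.

Definition zariski_closed (Z : {ffun 'I_n -> proj_space} -> Prop) : Prop :=
  exists2 E : mpoly (n * m) F -> Prop, (forall p, E p -> multihomogeneous p) &
    forall x, Z x <-> (forall p, E p -> vanishes_at p x).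

Definition irreducible_variety (V : {ffun 'I_n -> proj_space} -> Prop) : Prop :=
  (exists x, V x) /\
  forall Z1 Z2, zariski_closed Z1 -> zariski_closed Z2 ->
    (forall x, V x -> Z1 x \/ Z2 x) ->
    (forall x, V x -> Z1 x) \/ (forall x, V x -> Z2 x).

End ProjectiveSpace.

Section PointVarieties.
Variables (F : fieldType) (m : nat) (A : algType F).
Variable phi : {lrmorphism freealg F m -> A}.

(* lam is the sequence of projective points recording some point module: row
   vectors l i represent the points lam i and e_i . x_j = l_(i, j) e_(i+1). *)
Definition point_sequence (lam : nat -> proj_space F m) : Prop :=
  exists (P : lmodType A^c) (G : nat -> P -> Prop) (e : nat -> P)
         (l : nat -> 'rV[F]_m),
    [/\ point_module phi G,
        (forall i, G i (e i) /\ e i <> 0),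
        (forall i j,
           ract (e i) (generator phi j) = ract (e i.+1) (l i 0 j)%:A)
      & (forall i, val (lam i) = <[l i]>%VS)].

Definition point_variety (n : nat) (x : {ffun 'I_n.+1 -> proj_space F m}) :
    Prop :=
  exists2 lam, point_sequence lam & forall i, x i = lam i.

Definition point_varieties_irreducible : Prop :=
  forall n, irreducible_variety (@point_variety n).

End PointVarieties.

(* Main.v *)
Require Import Defs.
From HB Require Import structures.
From mathcomp Require Import all_boot all_order all_algebra.
From mathcomp Require Import finmap.
From mathcomp Require Import monalg.
From mathcomp Require Import mpoly.
From Stdlib Require Import Classical.

Set Implicit Arguments.
Unset Strict Implicit.
Unset Printing Implicit Defensive.

Import GRing.Theory.
Local Open Scope ring_scope.

(* A non-zero word extends, by prolongability, to an infinite word all of whose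
   factors are non-zero, and such a word is the sequence of a point module.
   Conversely, if the coordinates l_(0, j_0), ..., l_(n, j_n) of a point sequence
   are non-zero, then x_(j_0) ... x_(j_n) is non-zero in A.  Let T_i be the set of
   letters at position i of non-zero words.  For j_i in T_i, each of the n + 1 open
   conditions l_(i, j_i) <> 0 is satisfied somewhere on P_n(A), hence by
   irreducibility all are satisfied at one point: the non-zero words of length
   n + 1 are exactly T_0 x ... x T_n.  The sets T_i decrease, so they stabilise at
   T = T_r, and every word over T is non-zero.  A non-zero word has at most r
   letters outside T, so these letters generate a nilpotent ideal, and the
   quotient is free on T. *)

(** * Words and coefficients in the free algebra *)

Section FreeAlgebra.
Variables (F : fieldType) (m : nat).
Implicit Types (p q : freealg F m) (s t : seq 'I_m).

Lemma fmonomM s t : mmul (FMonom s) (FMonom t) = FMonom (s ++ t).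
Proof. by apply/eqP; rewrite fmP fmM. Qed.

Lemma fmonom1 : mone = FMonom [::] :> {fmonom 'I_m}.
Proof. by apply/eqP; rewrite fmP fm1. Qed.

Lemma eq_fmonom s t : (FMonom s == FMonom t) = (s == t).
Proof. by rewrite fmP. Qed.

Lemma word_eltM s t :
  word_elt F (FMonom (s ++ t)) = word_elt F (FMonom s) * word_elt F (FMonom t).
Proof. by rewrite /word_elt malgM_def fgmulUU mulr1 fmonomM. Qed.

Lemma word_elt1 : word_elt F (FMonom [::]) = 1 :> freealg F m.
Proof. by rewrite /word_elt -fmonom1. Qed.

Lemma mcoeff_word w v : monalg.mcoeff v (word_elt F w : freealg F m) = (w == v)%:R.
Proof. exact: mcoeffU1. Qed.

Lemma freealg_coef0 w : monalg.mcoeff w (0 : freealg F m) = 0.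
Proof. exact: monalg.mcoeff0. Qed.

Lemma freealg_coefD w p q :
  monalg.mcoeff w (p + q) = monalg.mcoeff w p + monalg.mcoeff w q.
Proof. exact: monalg.mcoeffD. Qed.

Lemma freealg_coefZ w c p :
  monalg.mcoeff w (c *: p) = c * monalg.mcoeff w p.
Proof. exact: monalg.mcoeffZ. Qed.

Lemma freealgE p :
  p = \sum_(w <- monalg.msupp p) monalg.mcoeff w p *: word_elt F w.
Proof.
rewrite {1}[p]monalgE; apply: eq_bigr => w _.
by apply/malgP => v; rewrite freealg_coefZ !monalg.mcoeffU mulr_natr.
Qed.

(** A word s has exactly [size s + 1] factorisations into two words, one for each cut position k. *)
Lemma mcoeffM_word s p q :
  monalg.mcoeff (FMonom s) (p * q) =
  \sum_(k < (size s).+1) monalg.mcoeff (FMonom (take k s)) p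
                         * monalg.mcoeff (FMonom (drop k s)) q.
Proof.
have lhs : monalg.mcoeff (FMonom s) (p * q) =
    \sum_(u <- monalg.msupp p) \sum_(v <- monalg.msupp q)
      monalg.mcoeff u p * monalg.mcoeff v q * (u ++ v == s :> seq 'I_m)%:R.
  rewrite {1}[p]freealgE {1}[q]freealgE mulr_suml raddf_sum /=.
  apply: eq_bigr => -[u] _; rewrite mulr_sumr raddf_sum /=.
  refine (eq_bigr _ _) => -[v] _; rewrite -scalerAl -scalerAr -word_eltM.
  by rewrite !freealg_coefZ mulrA mcoeff_word eq_fmonom.
rewrite lhs.
have E (r : freealg F m) w : monalg.mcoeff w r =
    \sum_(u <- monalg.msupp r) monalg.mcoeff u r * (u == w)%:R.
  rewrite {1}[r]freealgE raddf_sum /=; apply: eq_bigr => u _.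
  by rewrite freealg_coefZ mcoeff_word.
under [RHS]eq_bigr => k _ do rewrite (E p) (E q) big_distrlr /=.
rewrite [RHS]exchange_big /=; refine (eq_bigr _ _) => -[u] _.
rewrite [RHS]exchange_big /=; refine (eq_bigr _ _) => -[v] _ /=.
under eq_bigr => k _ do rewrite mulrACA -natrM mulnb !eq_fmonom.
rewrite -mulr_sumr; congr (_ * _).
(* For given u and v, only the cut k = [size u] can return the pair, and it does so exactly when
   [u ++ v] is s. *)
have [<-|neq] := eqVneq (u ++ v) s; last first.
  rewrite big1 // => k _; case: andP => //= -[/eqP uE /eqP vE].
  by rewrite uE vE cat_take_drop eqxx in neq.
have ltu : (size u < (size (u ++ v)).+1)%N by rewrite size_cat ltnS leq_addr.
rewrite (bigD1 (Ordinal ltu)) //= take_size_cat // drop_size_cat // !eqxx.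
rewrite big1 ?addr0 // => k neqk; case: andP => //= -[/eqP uE _].
case/eqP: neqk; apply: val_inj => /=.
by rewrite [RHS](congr1 size uE) size_takel // -ltnS ltn_ord.
Qed.

End FreeAlgebra.

(** * Coordinates on the non-zero monomials of A *)

Section MonomialAlgebra.
Variables (F : fieldType) (m : nat) (A : algType F).
Variable phi : {lrmorphism freealg F m -> A}.
Hypothesis A_monomial : monomial_algebra phi.
Implicit Types (p q : freealg F m) (s t : seq 'I_m) (a b : A).

Local Notation mon s := (monomial phi (FMonom s)).

Lemma monomialM s t : mon (s ++ t) = mon s * mon t.
Proof. by rewrite /monomial word_eltM rmorphM. Qed.

Lemma monomial1 : mon [::] = 1.
Proof. by rewrite /monomial word_elt1 rmorph1. Qed.

Definition nonzero_word s := mon s != 0.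

Lemma nonzero_word_catl s t : nonzero_word (s ++ t) -> nonzero_word s.
Proof. by apply: contraNneq; rewrite monomialM => ->; rewrite mul0r. Qed.

Lemma nonzero_word_catr s t : nonzero_word (s ++ t) -> nonzero_word t.
Proof. by apply: contraNneq; rewrite monomialM => ->; rewrite mulr0. Qed.

Lemma phi_sum p : phi p =
  \sum_(w <- monalg.msupp p) monalg.mcoeff w p *: monomial phi w.
Proof.
by rewrite {1}[p]freealgE raddf_sum /=; apply: eq_bigr => w _; rewrite linearZ.
Qed.

(** Polynomials with no non-zero word in their support form a two-sided ideal, because factors of a
    non-zero word are non-zero; it contains the defining monomials. Hence the non-zero monomials are
    linearly independent in A. *)
Lemma phi_eq0 p s : phi p = 0 -> nonzero_word s -> monalg.mcoeff (FMonom s) p = 0.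
Proof.
case: A_monomial => W [_ _ ker] /ker pI; move: s.
apply: (pI (fun p => forall s, nonzero_word s -> monalg.mcoeff (FMonom s) p = 0)).
- split=> [s _|x y Ix Iy s Ls|a x Ix]; first exact: freealg_coef0.
  + by rewrite freealg_coefD Ix // Iy // addr0.
  + split=> s Ls; rewrite mcoeffM_word big1 // => k _.
      rewrite [X in _ * X]Ix ?mulr0 //.
      by apply: (@nonzero_word_catr (take k s)); rewrite cat_take_drop.
    rewrite [X in X * _]Ix ?mul0r //.
    by apply: (@nonzero_word_catl _ (drop k s)); rewrite cat_take_drop.
- move=> _ [w Ww ->] s Ls; rewrite mcoeff_word.
  case: eqP => // ws; case/eqP: Ls; rewrite -ws; apply/ker => J _; apply.
  by exists w.
Qed.

(** The boolean equality lets [xchoose] pick a lift. *)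
Lemma phi_surj a : exists p, phi p == a.
Proof. by case: A_monomial => W [_ /(_ a)[p <-] _]; exists p. Qed.

Definition free_lift a : freealg F m := xchoose (phi_surj a).

Lemma free_liftK a : phi (free_lift a) = a.
Proof. exact/eqP/(xchooseP (phi_surj a)). Qed.

(* The coordinate of a on the non-zero monomial s; meaningless (it depends on
   the choice of free_lift) when s vanishes in A. *)
Definition wcoef s a : F := monalg.mcoeff (FMonom s) (free_lift a).

(** Two lifts of one element differ by an element of the kernel, so [phi_eq0] makes the coordinate
    independent of the lift. *)
Lemma wcoef_phi s p : nonzero_word s -> wcoef s (phi p) = monalg.mcoeff (FMonom s) p.
Proof.
move=> Ls; apply/eqP; rewrite -subr_eq0 -monalg.mcoeffB.
by apply/eqP/phi_eq0 => //; rewrite raddfB /= free_liftK subrr.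
Qed.

Lemma wcoef_monomial s t : nonzero_word s -> wcoef s (mon t) = (t == s)%:R.
Proof. by move=> Ls; rewrite wcoef_phi // mcoeff_word eq_fmonom. Qed.

Lemma wcoefD s a b : nonzero_word s -> wcoef s (a + b) = wcoef s a + wcoef s b.
Proof.
move=> Ls; rewrite -[a in LHS]free_liftK -[b in LHS]free_liftK -raddfD /=.
by rewrite wcoef_phi // freealg_coefD.
Qed.

Lemma wcoefZ s c a : nonzero_word s -> wcoef s (c *: a) = c * wcoef s a.
Proof.
by move=> Ls; rewrite -[a in LHS]free_liftK -linearZ /= wcoef_phi // freealg_coefZ.
Qed.

Lemma wcoef1 s : nonzero_word s -> wcoef s 1 = (s == [::])%:R.
Proof. by move=> Ls; rewrite -monomial1 wcoef_monomial // eq_sym. Qed.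

Lemma wcoefM s a b : nonzero_word s ->
  wcoef s (a * b) = \sum_(k < (size s).+1) wcoef (take k s) a * wcoef (drop k s) b.
Proof.
move=> Ls; rewrite -[a in LHS]free_liftK -[b in LHS]free_liftK -rmorphM /=.
by rewrite wcoef_phi // mcoeffM_word.
Qed.

(** A strict bound on the lengths of the words in the chosen lift; through [entry_large] it makes
    the action send polynomials to polynomials. *)
Definition lift_bound a := (\max_(w <- monalg.msupp (free_lift a)) (fdeg w).+1)%N.

Lemma wcoef_large s a : (lift_bound a <= size s)%N -> wcoef s a = 0.
Proof.
move=> Ds; apply/mcoeff_outdom/negP => ss; move: Ds; rewrite leqNgt.
by rewrite (leq_trans _ (leq_bigmax_seq _ ss _)).
Qed.

End MonomialAlgebra.

(** * The point module of an infinite word *)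

Section InfiniteWord.
Variables (F : fieldType) (m : nat) (A : algType F).
Variable phi : {lrmorphism freealg F m -> A}.
Hypothesis A_monomial : monomial_algebra phi.
Variable w : nat -> 'I_m.

(** Truncated subtraction makes the factor empty when n <= i, which is why [entry] tests i <= n
    separately. *)
Definition factor i n : seq 'I_m := [seq w k | k <- iota i (n - i)].

Lemma size_factor i n : size (factor i n) = (n - i)%N.
Proof. by rewrite size_map size_iota. Qed.

Lemma factor_cat i j n : (i <= j <= n)%N ->
  factor i n = factor i j ++ factor j n.
Proof.
case/andP=> ij jn; rewrite -map_cat; congr map.
by rewrite -{2}(subnKC ij) -iotaD addnC addnBA // subnK.
Qed.

Hypothesis prefix_nonzero : forall n, nonzero_word phi (factor 0 n).

Lemma factor_nonzero i n : nonzero_word phi (factor i n).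
Proof.
have [/ltnW ni|le_in] := ltnP n i.
  suff -> : factor i n = factor 0 0 by [].
  by apply: size0nil; rewrite size_factor; apply/eqP.
apply: (@nonzero_word_catr _ _ _ _ (factor 0 i)).
by rewrite -factor_cat ?leq0n.
Qed.

(* The matrix coefficients of the right action of a: e_i . a is the sum over n of
   entry a i n times e_n. *)
Definition entry (a : A) i n : F :=
  if (i <= n)%N then wcoef A_monomial (factor i n) a else 0.

Lemma entryD a b i n : entry (a + b) i n = entry a i n + entry b i n.
Proof.
rewrite /entry; case: ifP; rewrite ?addr0 // wcoefD //.
exact: factor_nonzero.
Qed.

(** A cut of the factor after k letters, as in [wcoefM], is the intermediate index j = i + k of a
    matrix product; the indices j < i contribute 0. *)
Lemma entryM a b i n : entry (a * b) i n = \sum_(j < n.+1) entry a i j * entry b j n.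
Proof.
rewrite /entry; case: leqP => [le_in|lt_ni]; last first.
  rewrite big1 // => j _.
  by rewrite leqNgt (leq_trans _ lt_ni) ?ltnS ?leq_ord // mul0r.
rewrite wcoefM; last exact: factor_nonzero.
rewrite size_factor -subSn // -(big_mkord xpredT
  (fun k => wcoef A_monomial (take k (factor i n)) a *
            wcoef A_monomial (drop k (factor i n)) b)).
rewrite -[in RHS](big_mkord xpredT (fun j =>
  (if (i <= j)%N then wcoef A_monomial (factor i j) a else 0) *
  (if (j <= n)%N then wcoef A_monomial (factor j n) b else 0))).
rewrite [RHS](big_cat_nat (n := i)) ?leqW //=.
rewrite [X in _ = X + _]big_nat [X in _ = X + _]big1 ?add0r; last first.
  by move=> j /andP[_ ji]; rewrite leqNgt ji mul0r.
rewrite [RHS](@big_addn _ _ _ 0 n.+1 i); apply: eq_big_nat => k /andP[_ lt_k].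
have le_kn : (k + i <= n)%N by rewrite -ltnS addnC -ltn_subRL.
rewrite leq_addl le_kn (@factor_cat i (k + i)) ?leq_addl //.
by rewrite take_size_cat ?drop_size_cat // size_factor addnK.
Qed.

Lemma entry_alg c i n : entry c%:A i n = c * (i == n)%:R.
Proof.
rewrite /entry; case: leqP => [le_in|]; last first.
  by case: eqP => [->|]; rewrite ?ltnn // mulr0.
rewrite wcoefZ ?wcoef1; try exact: factor_nonzero.
by rewrite -size_eq0 size_factor subn_eq0 eqn_leq le_in.
Qed.

Lemma entry_large a i n : (lift_bound A_monomial a + i <= n)%N -> entry a i n = 0.
Proof.
rewrite /entry => le_n; case: ifP => // _; rewrite wcoef_large //.
by rewrite size_factor leq_subRL ?(leq_trans _ le_n) ?leq_addl // addnC.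
Qed.

(* The point module of the word w, with e_n = 'X^n.  The two hypotheses are
   phantom arguments: the module structure below depends on them. *)
Definition word_module : Type :=
  (fun _ _ => {poly F}) A_monomial prefix_nonzero.

HB.instance Definition _ := GRing.Zmodule.on word_module.

Definition word_act (a : A^c) (f : word_module) : word_module :=
  \poly_(n < size (f : {poly F}) + lift_bound A_monomial a)
    \sum_(i < n.+1) (f : {poly F})`_i * entry a i n.

Lemma coef_word_act (a : A) (f : word_module) n :
  (word_act a f : {poly F})`_n = \sum_(i < n.+1) (f : {poly F})`_i * entry a i n.
Proof.
rewrite coef_poly; case: ltnP => // le_n.
rewrite big1 // => i _; have [le_i|lt_i] := leqP (size (f : {poly F})) i.
  by rewrite nth_default ?mul0r.
rewrite entry_large ?mulr0 // (leq_trans _ le_n) // addnC leq_add2r.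
exact: ltnW.
Qed.

(** Entries below the diagonal vanish, so the range of summation may grow; [word_actA] needs a range
    independent of the outer index before it exchanges sums. *)
Lemma coef_word_act_wide (a : A) (f : word_module) n N : (n < N)%N ->
  (word_act a f : {poly F})`_n = \sum_(i < N) (f : {poly F})`_i * entry a i n.
Proof.
move=> nN; rewrite coef_word_act.
rewrite (big_ord_widen N (fun i => (f : {poly F})`_i * entry a i n) nN).
rewrite big_mkcond /=.
apply: eq_bigr => i _; case: ltnP => // ni.
by rewrite /entry leqNgt ni mulr0.
Qed.

Lemma word_actA (a b : A^c) f : word_act a (word_act b f) = word_act (a * b) f.
Proof.
apply/polyP => n; rewrite !coef_word_act.
under eq_bigr => j _ do rewrite (coef_word_act_wide _ _ (ltn_ord j)) mulr_suml.
rewrite exchange_big /=; apply: eq_bigr => i _.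
(* The product of a and b in [A^c] is b * a in A. *)
rewrite [entry _ _ _](entryM b a) mulr_sumr.
by apply: eq_bigr => j _; rewrite mulrA.
Qed.

Lemma word_act1 : left_id 1 word_act.
Proof.
move=> f; apply/polyP => n; rewrite coef_word_act.
have E i : entry (1 : A^c) i n = (i == n)%:R.
  by rewrite -[1 : A^c](scale1r (1 : A)) entry_alg mul1r.
under eq_bigr do rewrite E.
rewrite big_ord_recr /= eqxx mulr1 big1 ?add0r // => i _.
by rewrite ltn_eqF ?mulr0.
Qed.

Lemma word_actDr : right_distributive word_act +%R.
Proof.
move=> a f g; apply/polyP => n.
rewrite coefD !coef_word_act -big_split /=; apply: eq_bigr => i _.
by rewrite coefD mulrDl.
Qed.

Lemma word_actDl f : {morph word_act^~ f : a b / a + b}.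
Proof.
move=> a b; apply/polyP => n.
rewrite coefD !coef_word_act -big_split /=; apply: eq_bigr => i _.
by rewrite [entry _ _ _](entryD a b) mulrDr.
Qed.

HB.instance Definition _ := GRing.Zmodule_isLmodule.Build A^c word_module
  word_actA word_act1 word_actDr word_actDl.

Lemma coef_ract (a : A) (f : word_module) n :
  (ract f a : {poly F})`_n = \sum_(i < n.+1) (f : {poly F})`_i * entry a i n.
Proof. exact: coef_word_act. Qed.

Lemma coef_ractXn (a : A) i n :
  (ract ('X^i : word_module) a : {poly F})`_n = entry a i n.
Proof.
rewrite coef_ract; have [le_in|lt_ni] := ltnP i n.+1.
  rewrite (bigD1 (Ordinal le_in)) //= coefXn eqxx mul1r big1 ?addr0 // => j.
  by rewrite coefXn => /negPf; rewrite -val_eqE /= => ->; rewrite mul0r.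
rewrite big1 => [|j _]; first by rewrite /entry leqNgt lt_ni.
by rewrite coefXn ltn_eqF ?mul0r // (leq_trans (ltn_ord j)).
Qed.

Lemma ract_alg c (f : word_module) : ract f c%:A = c *: (f : {poly F}).
Proof.
apply/polyP => n; rewrite coef_ract coefZ big_ord_recr /= entry_alg eqxx mulr1.
rewrite big1 ?add0r 1?mulrC // => i _.
by rewrite entry_alg ltn_eqF ?mulr0.
Qed.

Definition word_grading n (f : word_module) : Prop :=
  exists c, f = c *: ('X^n : {poly F}).

Lemma word_gradingP n (f : word_module) :
  word_grading n f <-> forall k, k != n -> (f : {poly F})`_k = 0.
Proof.
split=> [[c ->] k kn|f0]; first by rewrite coefZ coefXn (negPf kn) mulr0.
exists (f : {poly F})`_n; apply/polyP => k; rewrite coefZ coefXn.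
by case: eqVneq => [->|/f0]; rewrite ?mulr1 ?mulr0.
Qed.

Lemma word_point_module : point_module phi word_grading.
Proof.
split.
- move=> n; exists ('X^n : {poly F}); first exact/eqP/monic_neq0/monicXn.
  by move=> f; split=> -[c ->]; exists c; rewrite ract_alg.
- move=> f; exists (size (f : {poly F})).
  exists (fun n => (f : {poly F})`_n *: ('X^n : {poly F})).
  split=> [n|]; first by exists (f : {poly F})`_n.
  by rewrite -[LHS](coefK (f : {poly F})) poly_def.
- move=> N y Gy y0 n nN; have [c yn] := Gy n.
  have : (\sum_(k < N) (y k : {poly F}))`_n = 0
    by exact: etrans (congr1 (fun f : {poly F} => f`_n) y0) (coef0 _ _).
  rewrite coef_sum (bigD1 (Ordinal nN)) //= big1 ?addr0.
    by rewrite yn coefZ coefXn eqxx mulr1 => ->; rewrite scale0r.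
  move=> k kn; have [d ->] := Gy k.
  by rewrite coefZ coefXn eq_sym (negPf (kn : (k : nat) != n)) mulr0.
- move=> i j f a [c ->] [p ph <-]; apply/word_gradingP => k kij.
  rewrite -ract_alg.
  have -> : ract (ract ('X^i : word_module) c%:A) (phi p)
       = ract ('X^i : word_module) (c *: phi p).
    by rewrite /ract scalerA; congr (_ *: _); rewrite /= [LHS]mulr_algl.
  (* A non-zero entry at k forces the factor from i to k into the homogeneous lift p, so its length
     k - i is the degree j. *)
  rewrite coef_ractXn /entry; case: ifP => // le_ik.
  rewrite wcoefZ; last exact: factor_nonzero.
  rewrite wcoef_phi; last exact: factor_nonzero.
  have [->|/ph] := eqVneq (monalg.mcoeff (FMonom (factor i k)) p) 0.
    exact: mulr0.
  rewrite /fdeg /= size_factor => jE.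
  by rewrite -jE subnKC // eqxx in kij.
- exists ('X^0 : {poly F}); first by exists 1; rewrite scale1r.
  (* The prefix of length n sends e_0 to e_n, so the prefixes weighted by the coefficients of f send
     e_0 to f. *)
  move=> f; exists (\sum_(n < size (f : {poly F}))
     (f : {poly F})`_n *: monomial phi (FMonom (factor 0 n))).
  apply/polyP => k; rewrite coef_ractXn.
  rewrite /entry leq0n.
  (* Truncating the left side at the size of f allows an induction on that bound. *)
  rewrite -{1}[f : {poly F}]coefK coef_poly.
  elim: (size _) => [|N IH].
    rewrite big_ord0 -(scale0r 1) wcoefZ ?mul0r //; exact: factor_nonzero.
  rewrite big_ord_recr wcoefD /=; last exact: factor_nonzero.
  rewrite -IH wcoefZ ?wcoef_monomial; try exact: factor_nonzero.
  have -> : (factor 0 N == factor 0 k) = (N == k).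
    apply/eqP/eqP => [/(congr1 size)|-> //].
    by rewrite !size_factor !subn0.
  rewrite ltnS leq_eqVlt.
  by have [->|] := eqVneq k N; rewrite ?ltnn ?mulr1 ?add0r // mulr0 addr0.
Qed.

End InfiniteWord.

(** * Point sequences and non-zero words *)

Section PointSequences.
Variables (F : fieldType) (m : nat) (A : algType F).
Variable phi : {lrmorphism freealg F m -> A}.

Fact coord_point_subproof (j : 'I_m) :
  \dim <[delta_mx 0 j : 'rV[F]_m]> == 1%N.
Proof.
suff -> : \dim <[delta_mx 0 j : 'rV[F]_m]> = (true : nat) by [].
rewrite dim_vline; congr nat_of_bool; apply/eqP => /matrixP/(_ 0 j)/eqP.
by rewrite !mxE !eqxx oner_eq0.
Qed.

Definition coord_point (j : 'I_m) : proj_space F m :=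
  exist _ <[delta_mx 0%R j]>%VS (coord_point_subproof j).

(** Among the generators only the letter [w i] acts non-trivially on e_i, and it gives e_(i+1); the
    row of coordinates is therefore a unit vector. *)
Lemma word_point_sequence (w : nat -> 'I_m) :
  monomial_algebra phi -> (forall n, nonzero_word phi (factor w 0 n)) ->
  point_sequence phi (fun i => coord_point (w i)).
Proof.
move=> A_monomial w_nz.
exists (word_module A_monomial w_nz), (@word_grading _ _ _ _ A_monomial w w_nz).
exists (fun n => 'X^n : {poly F}), (fun i => delta_mx 0 (w i)).
split=> //.
- exact: word_point_module.
- move=> i; split; first by exists 1; rewrite scale1r.
  exact/eqP/monic_neq0/monicXn.
- move=> i j; apply/polyP => n; rewrite !coef_ractXn entry_alg //.
  rewrite /generator fmuE /entry; case: ifP => [le_in|lt_in].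
    rewrite wcoef_monomial; last exact: factor_nonzero.
    rewrite mxE eqxx /=; have [<-|neq] := eqVneq i.+1 n.
      by rewrite mulr1 /factor subSnn /= eqseq_cons andbT.
    rewrite mulr0; case: eqP => // /(congr1 size) /=.
    by rewrite size_factor => sz; rewrite -(subnKC le_in) -sz addn1 eqxx in neq.
  by rewrite gtn_eqF ?mulr0 // ltnS ltnW // ltnNge lt_in.
Qed.

Section ActionOnWords.
Variables (P : lmodType A^c) (e : nat -> P) (l : nat -> 'rV[F]_m).
Hypothesis e_gen : forall i j,
  ract (e i) (generator phi j) = ract (e i.+1) (l i 0 j)%:A.

Lemma ractM (x : P) (a b : A) : ract x (a * b) = ract (ract x a) b.
Proof. by rewrite /ract scalerA. Qed.

Lemma ract_algC (x : P) (a : A) c : ract (ract x c%:A) a = ract (ract x a) c%:A.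
Proof. by rewrite -!ractM mulr_algl mulr_algr. Qed.

(** Each letter moves one step along the sequence e; c is the product of the coordinates met on the
    way. *)
Lemma ract_monomial j0 s i :
  (forall k, (k < size s)%N -> l (i + k)%N 0 (nth j0 s k) != 0) ->
  exists2 c, c != 0 &
    ract (e i) (monomial phi (FMonom s)) = ract (e (i + size s)%N) c%:A.
Proof.
elim: s i => [|j s IH] i l_nz.
  exists 1; first exact: oner_neq0.
  by rewrite monomial1 addn0 scale1r.
have [k ks|c c_nz es] := IH i.+1.
  by have := l_nz k.+1 ks; rewrite addnS.
have lj : l i 0 j != 0 by have := l_nz 0 isT; rewrite addn0.
exists (l i 0 j * c); first by rewrite mulf_neq0.
rewrite -cat1s monomialM ractM -fmuE -/(generator phi j) e_gen ract_algC es.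
by rewrite -ractM addSnnS mulr_algl scalerA (mulrC c).
Qed.

End ActionOnWords.

(** By contraposition: if all these coordinates were non-zero, s would send e_0 to a non-zero
    multiple of e_(size s), and so be non-zero in A. *)
Lemma point_sequence_vanish lam j0 s : point_sequence phi lam ->
  ~~ nonzero_word phi s ->
  exists2 k, (k < size s)%N &
    forall v, val (lam k) = <[v]>%VS -> v 0 (nth j0 s k) = 0.
Proof.
move=> [P [G [e [l [_ Ge e_gen lamE]]]]] s0.
have [/existsP[k /eqP lk0]|] :=
    boolP [exists k : 'I_(size s), l k 0 (nth j0 s k) == 0].
  exists k => // v; rewrite lamE => lv.
  have /vlineP[c ->] : v \in <[l k]>%VS by rewrite lv memv_line.
  by rewrite mxE lk0 mulr0.
rewrite negb_exists => /forallP l_nz; case/negP: s0.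
have [k ks|c c_nz] := @ract_monomial _ _ _ e_gen j0 s 0.
  exact: l_nz (Ordinal ks).
apply: contra_eq_neq => ->.
have -> : ract (e 0%N) 0 = 0 by rewrite /ract (scale0r (e 0%N)).
apply/eqP => /esym e0; have [_] := Ge (0 + size s)%N; apply.
(* Scaling by the inverse of c would give e_(size s) = 0. *)
have := congr1 (fun x => ract x (c^-1)%:A) e0.
rewrite -ractM mulr_algl scalerA mulfV // scale1r /ract scaler0.
by rewrite [1 *: _](scale1r (e _)).
Qed.

(** The word is built greedily, one letter at a time; letter i is read off at stage i + 1, when
    position i is certainly filled. *)
Lemma prolongable_extension j0 s : prolongable phi -> nonzero_word phi s ->
  exists w : nat -> 'I_m, (forall n, nonzero_word phi (factor w 0 n)) /\
    forall k, (k < size s)%N -> w k = nth j0 s k.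
Proof.
move=> A_prol s_nz.
(* Prolongability makes [pick] succeed all along the iteration, so every stage stays non-zero. *)
pose step u := rcons u (odflt j0 [pick j | nonzero_word phi (rcons u j)]).
pose U k := iter k step s.
have U_nz k : nonzero_word phi (U k).
  elim: k => //= k IH; rewrite /step; case: pickP => //= no_ext.
  have [[[//|j v]] _] := A_prol _ (elimN eqP IH).
  rewrite -monomialM => /eqP jv_nz; have := no_ext j.
  by rewrite (@nonzero_word_catl _ _ _ _ _ v) // cat_rcons.
have sizeU k : size (U k) = (size s + k)%N.
  by elim: k => [|k IH] /=; rewrite ?addn0 // size_rcons IH addnS.
(* Later stages only append letters, so a filled position never changes. *)
have nthU k d i : (i < size (U k))%N -> nth j0 (U (d + k)%N) i = nth j0 (U k) i.
  move=> ik; elim: d => //= d IH; rewrite /step nth_rcons ifT //.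
  by rewrite sizeU addnCA ltn_addl // -sizeU.
exists (fun i => nth j0 (U i.+1) i); split=> [n|k ks]; last first.
  by rewrite -[k.+1]addn0 nthU.
suff -> : factor (fun i => nth j0 (U i.+1) i) 0 n = take n (U n).
  by apply: (@nonzero_word_catl _ _ _ _ _ (drop n (U n))); rewrite cat_take_drop.
have sz : size (take n (U n)) = n by rewrite size_takel // sizeU leq_addl.
apply: (@eq_from_nth _ j0); rewrite size_factor subn0 ?sz // => i lt_in.
rewrite (nth_map 0) ?size_iota ?subn0 // nth_iota // add0n nth_take //.
by rewrite -[in RHS](subnK lt_in) nthU // sizeU addnS ltnS leq_addl.
Qed.

End PointSequences.

(** * Irreducibility and the vanishing of coordinates *)

Section Irreducibility.
Variables (F : fieldType) (m n : nat).
Implicit Types (x : {ffun 'I_n -> proj_space F m}) (u : 'I_n -> 'I_m).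

(** Quantifying over all representatives matches [vanishes_at] and avoids choosing one. *)
Definition coord_vanish (L : proj_space F m) (j : 'I_m) : Prop :=
  forall v, val L = <[v]>%VS -> v 0 j = 0.

Lemma proj_spaceE (L : proj_space F m) : val L = <[vpick (val L)]>%VS.
Proof.
apply/esym/eqP; rewrite eqEdim -memvE memv_pick (eqP (valP L)) dim_vline.
by rewrite vpick0 -dimv_eq0 (eqP (valP L)).
Qed.

Lemma coord_vanish_pick (L : proj_space F m) j :
  vpick (val L) 0 j = 0 -> coord_vanish L j.
Proof.
move=> L0 v Lv; have /vlineP[c ->] : v \in <[vpick (val L)]>%VS.
  by rewrite -proj_spaceE Lv memv_line.
by rewrite mxE L0 mulr0.
Qed.

(** The set is cut out by a single monomial, the product of the coordinates [u i] on the factors i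
    in r. *)
Lemma zariski_closed_coords u (r : seq 'I_n) :
  zariski_closed (fun x => exists2 i, i \in r & coord_vanish (x i) (u i)).
Proof.
pose p : mpoly (n * m) F := \prod_(i <- r) mpolyX _ U_(mxvec_index i (u i)).
exists (eq p) => [_ <-|x].
  rewrite /p mprodXE; set e := (X in mpolyX _ X).
  (* A monomial is multihomogeneous: its multidegree sums the exponents over each factor. *)
  exists (fun i => \sum_(j < m) e (mxvec_index i j))%N => mu.
  by rewrite msuppX inE => /eqP ->.
have evalp (v : 'M[F]_(n, m)) :
    p.@[fun k => mxvec v 0 k] = \prod_(i <- r) v i (u i).
  rewrite rmorph_prod; apply: eq_bigr => i _.
  by rewrite /= mevalXU mxvecE.
split=> [[i ir xi0] _ <- v vx|p0].
  rewrite evalp; apply/eqP; rewrite prodf_seq_eq0; apply/hasP; exists i => //=.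
  by have := xi0 _ (vx i); rewrite mxE => ->.
have := p0 _ erefl (\matrix_i vpick (val (x i))).
rewrite evalp => /(_ _)/eqP; rewrite prodf_seq_eq0.
case/(_ _)/hasP => [i|i ir /=].
  by rewrite rowK -proj_spaceE.
by rewrite mxE => /eqP xi0; exists i => //; apply: coord_vanish_pick.
Qed.

(** Irreducibility splits off one position of r at a time; an empty r is excluded because V has a
    point. *)
Lemma irreducible_coords V u (r : seq 'I_n) : irreducible_variety V ->
  (forall x, V x -> exists2 i, i \in r & coord_vanish (x i) (u i)) ->
  exists2 i, i \in r & forall x, V x -> coord_vanish (x i) (u i).
Proof.
move=> [[x0 Vx0] irrV]; elim: r => [/(_ _ Vx0)[//]|i r IH] Vr.
have := irrV _ _ (zariski_closed_coords u [:: i]) (zariski_closed_coords u r).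
case=> [x /Vr[k]|Vi|/IH[k kr Vk]].
- rewrite inE => /orP[/eqP -> xi|kr xk]; first by left; exists i; rewrite ?inE.
  by right; exists k.
- exists i; first exact: mem_head.
  by move=> x /Vi[k]; rewrite inE => /eqP ->.
- by exists k; rewrite ?inE ?kr ?orbT.
Qed.

End Irreducibility.

(** If s vanished, each point of the variety would have a vanishing coordinate, and by
    irreducibility one position i would vanish on the whole variety. Extending the word that has the
    right letter at i gives a point where that coordinate is non-zero. *)
Lemma irreducible_exchange (F : fieldType) (m : nat) (A : algType F)
    (phi : {lrmorphism freealg F m -> A}) (s : seq 'I_m) (j0 : 'I_m) :
  monomial_algebra phi -> prolongable phi -> point_varieties_irreducible phi ->
  (forall k, (k < size s)%N -> exists t,
     [/\ nonzero_word phi t, (k < size t)%N & nth j0 t k = nth j0 s k]) ->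
  nonzero_word phi s.
Proof.
move=> A_mon A_prol A_irr; case sz: (size s) => [|n] ext_s.
  (* The empty word is treated apart: [point_variety n] has n + 1 factors and so handles words of
     length n + 1. *)
  rewrite (size0nil sz) /nonzero_word monomial1; exact: oner_neq0.
apply: contraT => s0.
have [x [lam lamP xE]|i _ Vi] :=
    @irreducible_coords _ _ _ _ (fun i => nth j0 s i) (enum 'I_n.+1) (A_irr n).
  have [k] := point_sequence_vanish j0 lamP s0.
  rewrite sz => kn lamk; exists (Ordinal kn); first by rewrite mem_enum.
  by rewrite /coord_vanish xE.
have [t [t_nz lt_it tE]] := ext_s i (ltn_ord i).
have [w [w_nz wE]] := prolongable_extension j0 A_prol t_nz.
have /Vi/(_ (delta_mx 0 (w i))) :
    point_variety phi [ffun i : 'I_n.+1 => coord_point F (w i)].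
  exists (fun i => coord_point F (w i)); first exact: word_point_sequence.
  by move=> k; rewrite ffunE.
rewrite ffunE => /(_ erefl)/eqP.
by rewrite mxE wE // tE !eqxx oner_eq0.
Qed.

Lemma two_sided_ideal_gen (R : nzRingType) (S : R -> Prop) :
  two_sided_ideal (ideal_gen S).
Proof.
split=> [J [] //|x y Sx Sy J JI SJ|a x Sx].
- by have [_ + _] := JI; apply; [apply: Sx|apply: Sy].
- by split=> J JI SJ; have [_ _ /(_ a x (Sx J JI SJ))[]] := JI.
Qed.

Lemma ideal_gen_mem (R : nzRingType) (S : R -> Prop) x : S x -> ideal_gen S x.
Proof. by move=> Sx J _; apply. Qed.

(** * The ideal of the letters outside [T] and its quotient *)

Section FreeLetters.
Variables (F : fieldType) (m : nat) (A : algType F).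
Variable phi : {lrmorphism freealg F m -> A}.
Hypothesis A_monomial : monomial_algebra phi.
Variable T : {set 'I_m}.

Definition dead_letters (a : A) : Prop :=
  ideal_gen (fun b => exists2 i, i \in ~: T & b = generator phi i) a.

Section Nilpotent.
Variable r : nat.
Hypothesis T_count : forall s, nonzero_word phi s ->
  (count (fun j => j \notin T) s <= r)%N.

(** A filtration of A whose step d contains the d-th power of the ideal [dead_letters]. *)
Definition dead_depth d (a : A) : Prop := exists2 p, phi p = a &
  forall s, monalg.mcoeff (FMonom s) p != 0 -> (d <= count (fun j => j \notin T) s)%N.

(** A word of a product splits into words of the two factors, and the numbers of letters outside [T]
    add up. *)
Lemma dead_depthM d e a b :
  dead_depth d a -> dead_depth e b -> dead_depth (d + e) (a * b).
Proof.
move=> [p <- pd] [q <- qe]; exists (p * q); first by rewrite rmorphM.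
move=> s; apply: contraNT; rewrite -ltnNge => lt_s.
rewrite mcoeffM_word big1 // => k _.
have [->|/pd le_d] := eqVneq (monalg.mcoeff (FMonom (take k s)) p) 0.
  by rewrite mul0r.
have [->|/qe le_e] := eqVneq (monalg.mcoeff (FMonom (drop k s)) q) 0.
  by rewrite mulr0.
by move: lt_s; rewrite -{1}(cat_take_drop k s) count_cat ltnNge leq_add.
Qed.

Lemma dead_depth0 a : dead_depth 0 a.
Proof. by exists (free_lift A_monomial a); rewrite ?free_liftK. Qed.

(** The elements of depth 1 form a two-sided ideal containing the generators of [dead_letters]. *)
Lemma dead_letters_depth a : dead_letters a -> dead_depth 1 a.
Proof.
apply=> [|_ [i iT ->]].
  split=> [|x y [p <- pd] [q <- qd]|x a' a'1].
  - by exists 0 => [|s]; rewrite ?raddf0 ?eqxx.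
  - exists (p + q) => [|s]; first by rewrite raddfD.
    rewrite freealg_coefD.
    have [-> |/pd //] := eqVneq (monalg.mcoeff (FMonom s) p) 0.
    by rewrite add0r => /qd.
  - split; first exact: dead_depthM (dead_depth0 x) a'1.
    exact: dead_depthM a'1 (dead_depth0 x).
exists (word_elt F (fmu i)) => // s; rewrite fmuE mcoeff_word eq_fmonom.
have [<- _|_] := eqVneq [:: i] s; last by rewrite eqxx.
by move: iT; rewrite /= inE => ->.
Qed.

(** A product of r + 1 elements has a lift in which every word has more than r letters outside [T],
    and such words vanish in A. *)
Lemma dead_letters_nilpotent : nilpotent_ideal dead_letters.
Proof.
exists r.+1 => a Na.
have [p <- pd] : dead_depth r.+1 (\prod_(i < r.+1) a i).
  elim: r.+1 a Na => [|n IH] a Na; first exact: dead_depth0.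
  rewrite big_ord_recr -[X in dead_depth X]addn1; apply: dead_depthM.
    by apply: IH => i; apply: Na.
  by apply: dead_letters_depth; apply: Na.
rewrite phi_sum big_seq big1 // => -[s].
rewrite -monalg.mcoeff_neq0 => /pd lt_r.
have [/T_count|/negPn/eqP ->] := boolP (nonzero_word phi s); last exact: scaler0.
by rewrite leqNgt lt_r.
Qed.

End Nilpotent.

Hypothesis T_free : forall s, all (mem T) s -> nonzero_word phi s.

Local Notation letter := (@enum_val _ (mem T)).

Lemma all_letter v : all (mem T) (map letter v).
Proof. by apply/allP => _ /mapP[i _ ->]; exact: enum_valP. Qed.

Lemma letter_nonzero v : nonzero_word phi (map letter v).
Proof. exact/T_free/all_letter. Qed.

Lemma all_mem_letter s : all (mem T) s -> exists v, s = map letter v.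
Proof.
elim: s => [|i s IH] /=; first by exists [::].
case/andP=> iT /IH[v ->]; exists (enum_rank_in iT i :: v) => /=.
by rewrite enum_rankK_in.
Qed.

Definition letter_index (j : 'I_m) : option 'I_#|T| :=
  [pick i | letter i == j].

Lemma letterK : pcancel letter letter_index.
Proof.
move=> i; rewrite /letter_index; case: pickP => [k /eqP/enum_val_inj -> //|].
by move/(_ i); rewrite eqxx.
Qed.

(* The quotient map onto the free algebra on T: forget every word that has a
   letter outside T. *)
Definition restrict (a : A) : freealg F #|T| :=
  [malg v in [fset FMonom (pmap letter_index (s : {fmonom 'I_m}))
                | s in monalg.msupp (free_lift A_monomial a)]%fset
     => wcoef A_monomial (map letter (v : {fmonom 'I_#|T|})) a].

(** The finite set in [restrict] only has to contain the support: [letter_index] recovers v from its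
    image, so no coefficient is lost. *)
Lemma mcoeff_restrict v a :
  monalg.mcoeff (FMonom v) (restrict a) = wcoef A_monomial (map letter v) a.
Proof.
rewrite monalg.mcoeffE; case: ifPn => // vD; apply/esym/eqP.
apply: contraNT vD; rewrite monalg.mcoeff_neq0 => vs.
apply/imfsetP; exists (FMonom (map letter v)) => //.
by rewrite /= (map_pK letterK).
Qed.

Lemma freealgP k (p q : freealg F k) :
  (forall v, monalg.mcoeff (FMonom v) p = monalg.mcoeff (FMonom v) q) -> p = q.
Proof. by move=> pq; apply/monalg.malgP => -[v]. Qed.

Lemma restrictD : {morph restrict : a b / a + b}.
Proof.
move=> a b; apply: freealgP => v; rewrite freealg_coefD !mcoeff_restrict.
exact/wcoefD/letter_nonzero.
Qed.

Lemma restrict_zmod_morphism : zmod_morphism restrict.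
Proof.
move=> a b; apply/eqP; rewrite -(addrC (- _)) eq_sym addrC subr_eq -restrictD.
by rewrite subrK.
Qed.

Lemma restrictZ : scalable restrict.
Proof.
move=> c a; apply: freealgP => v; rewrite freealg_coefZ !mcoeff_restrict.
exact/wcoefZ/letter_nonzero.
Qed.

Lemma restrict_monomial v :
  restrict (monomial phi (FMonom (map letter v))) = word_elt F (FMonom v).
Proof.
apply: freealgP => u; rewrite mcoeff_restrict wcoef_monomial.
  rewrite mcoeff_word eq_fmonom inj_eq //.
  exact/inj_map/enum_val_inj.
exact: letter_nonzero.
Qed.

(** The cuts of [map letter v] are the images of the cuts of v, so [wcoefM] and [mcoeffM_word] agree
    term by term. *)
Lemma restrict_monoid_morphism : monoid_morphism restrict.
Proof.
split=> [|a b].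
  by rewrite -(monomial1 phi) (restrict_monomial [::]) word_elt1.
apply: freealgP => v; rewrite mcoeffM_word mcoeff_restrict wcoefM.
  rewrite size_map; apply: eq_bigr => k _.
  by rewrite !mcoeff_restrict map_take map_drop.
exact: letter_nonzero.
Qed.

HB.instance Definition _ := GRing.isZmodMorphism.Build A (freealg F #|T|)
  restrict restrict_zmod_morphism.
HB.instance Definition _ := GRing.isMonoidMorphism.Build A (freealg F #|T|)
  restrict restrict_monoid_morphism.
HB.instance Definition _ := GRing.isScalable.Build F A (freealg F #|T|) *:%R
  restrict restrictZ.

Lemma dead_letters_quotient :
  exists pi : {lrmorphism A -> freealg F #|T|}, quotient_map dead_letters pi.
Proof.
exists restrict.
have [N0 ND NM] := two_sided_ideal_gen
  (fun b => exists2 i, i \in ~: T & b = generator phi i).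
split=> [|b|a]; first exact: two_sided_ideal_gen.
  exists (\sum_(v <- monalg.msupp b) monalg.mcoeff v b *:
            monomial phi (FMonom (map letter v))).
  rewrite [RHS]freealgE raddf_sum; apply: eq_bigr => -[v] _.
  by rewrite /= linearZ /= restrict_monomial.
(* The ideal lies in the kernel, which is itself an ideal and contains the generators outside
   [T]. *)
split=> [a0|]; last first.
  move/(_ (fun b => restrict b = 0)); apply=> [|_ [i iT ->]].
    split=> [|x y x0 y0|x y y0]; first exact: raddf0.
      by rewrite raddfD /= x0 y0 addr0.
    by split; rewrite rmorphM /= y0 ?mulr0 ?mul0r.
  apply: freealgP => v; rewrite mcoeff_restrict freealg_coef0 /generator fmuE.
  rewrite wcoef_monomial; last exact: letter_nonzero.
  case: eqP => // iE; move: iT; rewrite inE => /negP[].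
  by have /= := all_letter v; rewrite -iE /= andbT.
(* Conversely, in the lift of a the words over [T] have coefficient 0, and every other word contains
   a letter outside [T]. *)
rewrite -(free_liftK A_monomial a) phi_sum.
apply: (big_ind dead_letters) => // -[s] _.
have [/all_mem_letter[v ->]|sT] := boolP (all (mem T) s).
  suff -> : monalg.mcoeff (FMonom (map letter v)) (free_lift A_monomial a) = 0.
    by rewrite scale0r.
  by rewrite -[LHS](mcoeff_restrict v a) a0 freealg_coef0.
rewrite -mulr_algl; apply: (proj1 (NM _ _ _)).
case/allPn: sT => i /splitPr[u v] iT.
rewrite -cat1s !monomialM -fmuE -/(generator phi i).
apply: (proj1 (NM _ _ _)); apply: (proj2 (NM _ _ _)).
by apply: ideal_gen_mem; exists i; rewrite // inE.
Qed.

End FreeLetters.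

(** Descent on the cardinality: if [S r] is not contained in some [S i], the set at [maxn r i] is
    strictly smaller. *)
Lemma antitone_stable (T : finType) (S : nat -> {set T}) :
  (forall i j, (i <= j)%N -> S j \subset S i) ->
  exists r, forall i, S r \subset S i.
Proof.
move=> S_le.
suff: forall n r, (#|S r| < n)%N -> exists r, forall i, S r \subset S i.
  by move/(_ _ 0%N (ltnSn _)).
elim=> // n IH r; rewrite ltnS => le_n.
have [r_min|/not_all_ex_not[i /negP Sri]] :=
  classic (forall i, S r \subset S i); first by exists r.
apply: (IH (maxn r i)); apply: leq_trans le_n; apply: proper_card.
rewrite properE S_le ?leq_maxl //; apply: contra Sri => /subset_trans; apply.
by rewrite S_le ?leq_maxr.
Qed.

(** * Letters at a given position of non-zero words *)

Section LettersAt.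
Variables (F : fieldType) (m : nat) (A : algType F).
Variable phi : {lrmorphism freealg F m -> A}.

(** Cutting a non-zero word just after position i keeps it non-zero, so a finite quantification over
    tuples of length i suffices and membership is decidable. *)
Definition letters_at i : {set 'I_m} :=
  [set j | [exists t : i.-tuple 'I_m, nonzero_word phi (rcons t j)]].

Lemma letters_atP i j0 j : j \in letters_at i <-> exists t : seq 'I_m,
  [/\ nonzero_word phi t, (i < size t)%N & nth j0 t i = j].
Proof.
rewrite inE; split=> [/existsP[t t_nz]|[t [t_nz it <-]]].
  exists (rcons t j); rewrite size_rcons size_tuple ltnSn; split=> //.
  by rewrite nth_rcons size_tuple ltnn eqxx.
have sz : size (take i t) == i by rewrite size_takel // ltnW.
apply/existsP; exists (Tuple sz) => /=.
apply: (@nonzero_word_catl _ _ _ _ _ (drop i.+1 t)).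
by rewrite -take_nth // cat_take_drop.
Qed.

(** Dropping the first j - i letters brings a letter from position j to position i and leaves a
    non-zero suffix. *)
Lemma letters_at_antitone i j : (i <= j)%N -> letters_at j \subset letters_at i.
Proof.
move=> le_ij; apply/subsetP => k /(letters_atP _ k)[t [t_nz jt tk]].
apply/(letters_atP _ k); exists (drop (j - i) t); split.
- by apply: (@nonzero_word_catr _ _ _ _ (take (j - i) t)); rewrite cat_take_drop.
- by rewrite size_drop ltn_subRL subnK.
- by rewrite nth_drop subnK.
Qed.

End LettersAt.

Theorem proposition7p1 (F : closedFieldType) (m : nat) (A : algType F)
    (phi : {lrmorphism freealg F m -> A})
    (A_monomial : monomial_algebra phi)
    (A_prolongable : prolongable phi)
    (A_irreducible : point_varieties_irreducible phi) :
  exists N : A -> Prop,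
    [/\ two_sided_ideal N,
        nilpotent_ideal N,
        (exists S : {set 'I_m}, forall a,
           N a <-> ideal_gen (fun b => exists2 i, i \in S & b = generator phi i) a)
      & exists (k : nat) (Q : algType F) (pi : {lrmorphism A -> Q}),
          quotient_map N pi /\ alg_isomorphic Q (freealg F k)].
Proof.
have [r rP] := antitone_stable (letters_at_antitone phi).
pose T := letters_at phi r.
have T_free s : all (mem T) s -> nonzero_word phi s.
  case: s => [|j0 s] sT; first by rewrite /nonzero_word monomial1 oner_neq0.
  (* The stable set [T] lies in the set of letters at every position k. *)
  apply: (irreducible_exchange (j0 := j0)) => // k ks.
  by apply/letters_atP/(subsetP (rP k)); apply: (all_nthP j0 sT).
have T_count s : nonzero_word phi s -> (count (fun j => j \notin T) s <= r)%N.
  move=> s_nz; rewrite -(cat_take_drop r s) count_cat.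
  (* From position r on every letter belongs to [T], so only the first r letters can lie outside. *)
  have -> : count (fun j => j \notin T) (drop r s) = 0%N.
    apply/eqP; rewrite -leqn0 leqNgt -has_count -all_predC.
    apply/allP => j /(nthP j)[i]; rewrite size_drop ltn_subRL nth_drop => lt_i ij.
    rewrite /= negbK; apply: (subsetP (letters_at_antitone phi (leq_addr i r))).
    by apply/(letters_atP _ _ j); exists s.
  by rewrite addn0 (leq_trans (count_size _ _)) // size_take_min geq_minl.
exists (dead_letters phi T); split.
- exact: two_sided_ideal_gen.
- exact: dead_letters_nilpotent T_count.
- by exists (~: T).
- have [pi quot_pi] := dead_letters_quotient A_monomial T_free.
  (* The quotient is realised as the free algebra itself, so the isomorphism is the identity. *)
  exists #|T|, (freealg F #|T|), pi; split=> //.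
  by exists idfun; exists id.
Qed.
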